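(* Let $m\ge 1$, let $\{X_i\}_{i\ge1}$ be a stationary sequence with common distribution function $F$ and right end point $x_F$, satisfying $\lim_{s\nearrow}\frac{1-F(s)}{1-F(s^-)}=1$, and let $\{u_n^{(\tau)}\}$ be the associated normalising thresholds described in the context. Suppose that $FD_{n,m}$ exists for all sufficiently large $n$. Let $\theta>0$, let $\boldsymbol{\pi}$ be a probability distribution on $\{1,2,\ldots\}$, and for $\tau>0$ let $N^\tau$ be a compound Poisson random variable with rate $\theta\tau$ and cluster distribution $\boldsymbol{\pi}$. Suppose that there is $\tau_0>0$ such that for each integer $k\ge m$, as $n\to\infty$, $\mathbb{P}(N_{u_n^{(\tau)},n}=k\mid N_{u_n^{(\tau)},n}\ge m)$ converges to $\mathbb{P}(N^\tau=k\mid N^\tau\ge m)$ uniformly in $\tau\in(0,\tau_0]$. Then for every $A\subset\mathbb{Z}_m:=\{m,m+1,\ldots\}$, $$\lim_{n\to\infty}FD_{n,m}(A)=\frac{\boldsymbol{\pi}^{*\mathcal{I}_m}(A)}{\boldsymbol{\pi}^{*\mathcal{I}_m}(\mathbb{Z}_m)},$$ where $\boldsymbol{\pi}^{*j}$ is the $j$-fold convolution of $\boldsymbol{\pi}$ and $\mathcal{I}_m=\min\{i:\boldsymbol{\pi}^{*i}(\mathbb{Z}_m)>0\}$. In particular (for $m=1$), $\lim_{n\to\infty}FD_{n,1}=\boldsymbol{\pi}$.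
   Context: For a stationary sequence $X_1,X_2,\ldots$ with common distribution function $F$, $x_F:=\sup\{t:F(t)<1\}$ is the right end point of $F$, and $s\nearrow$ means that $s$ approaches $x_F$ from below. $F(s^-)$ denotes the left limit of $F$ at $s$. The number of exceedances above $s$ is $N_{s,n}:=\sum_{i=1}^n \mathbf{1}_{(s,\infty)}(X_i)$. The fragility distribution of order $m$ is $FD_{n,m}:=\lim_{s\nearrow}\mathcal{L}(N_{s,n}\mid N_{s,n}\ge m)$; it exists if $FD_{n,m}(A):=\lim_{s\nearrow}\mathbb{P}(N_{s,n}\in A)/\mathbb{P}(N_{s,n}\ge m)$ exists for all $A\subset\{m,m+1,\ldots,n\}$ (and $FD_{n,m}$ is viewed as a distribution on $\mathbb{Z}_m$). Thresholds: for $0<\tau<\infty$, $\{u_n^{(\tau)}\}_{n\ge1}$ are real numbers $u_n^{(\tau)}<x_F$, obtained by taking appropriate percentiles of $F$, such that $n(1-F(u_n^{(\tau)}))\to\tau$ as $n\to\infty$ for each $\tau$, and, for each fixed $n$, $u_n^{(\tau)}\to x_F$ as $\tau\downarrow0$. A compound Poisson random variable with rate $\lambda$ and cluster distribution $\boldsymbol{\pi}$ is distributed as $\sum_{i=1}^{P}\xi_i$, where $P$ is Poisson with mean $\lambda$ and $\xi_1,\xi_2,\ldots$ are i.i.d. with distribution $\boldsymbol{\pi}$, independent of $P$. *)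

(* Defs.v *)
From HB Require Import structures.
From mathcomp Require Import all_boot all_order all_algebra.
From mathcomp Require Import all_classical all_reals all_analysis.

Set Implicit Arguments.
Unset Strict Implicit.
Unset Printing Implicit Defensive.

Import Order.TTheory GRing.Theory Num.Theory.
Import numFieldNormedType.Exports.

Local Open Scope classical_set_scope.
Local Open Scope ring_scope.

(* Sequences are indexed from 0: [X i] below stands for X_{i+1}, so that
   X_1, ..., X_n are the [X i] with [i < n]. *)

Definition Zge (m : nat) : set nat := [set k | (m <= k)%N].

Section conditional_probability.
Context d (T : measurableType d) (R : realType) (P : probability T R).

Definition cond_prob (A B : set T) : R := fine (P (A `&` B)) / fine (P B).

(* The product rule over every finite subfamily. *)
Definition mutually_independent d' (T' : measurableType d')
    (W : nat -> {RV P >-> T'}) : Prop :=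
  forall (s : seq nat) (B : nat -> set T'), uniq s ->
    (forall i, measurable (B i)) ->
    P (\bigcap_(i in [set` s]) (W i @^-1` B i)) =
    (\prod_(i <- s) P (W i @^-1` B i))%E.

End conditional_probability.

Section stationary_sequence.
Context d (T : measurableType d) (R : realType) (P : probability T R).
Variable X : nat -> {RV P >-> R}.

Definition stationary : Prop :=
  forall (n h : nat) (B : set (n.-tuple R)), measurable B ->
    P [set w | B [tuple X i w | i < n]] =
    P [set w | B [tuple X (i + h)%N w | i < n]].

(* The common distribution function F, when [X] is stationary. *)
Definition marginal_df (t : R) : R := fine (cdf (X 0%N) t).

Definition nb_exceedances (s : R) (n : nat) (w : T) : nat :=
  \sum_(i < n) (s < X i w)%R.

End stationary_sequence.

Section right_end_point.
Context (R : realType).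
Implicit Types (F : R -> R).

Definition right_end_point F : \bar R :=
  ereal_sup [set t%:E | t in [set t | F t < 1]].

Definition left_limit F (s : R) : R := lim (F t @[t --> s^'-]).

(* Real numbers tending to [x] from below (strictly, if [x] is finite).  The
   value at -oo is irrelevant: a right end point is never -oo. *)
Definition from_below (x : \bar R) : set_system R :=
  match x with
  | r%:E => r^'-
  | +oo%E => +oo
  | -oo%E => -oo
  end.

#[global] Instance from_below_proper (x : \bar R) : ProperFilter (from_below x).
Proof. by case: x => [r||] /=; exact: _. Qed.

(* [u tau n] is the threshold u_n^(tau). *)
Definition normalising_thresholds F (u : R -> nat -> R) : Prop :=
  [/\ forall tau n, 0 < tau -> (0 < n)%N ->
        ((u tau n)%:E < right_end_point F)%E,
      forall tau, 0 < tau -> n%:R * (1 - F (u tau n)) @[n --> \oo] --> tau &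
      forall n, (0 < n)%N ->
        (u tau n)%:E @[tau --> 0^'+] --> right_end_point F].

End right_end_point.

Section fragility_distribution.
Context d (T : measurableType d) (R : realType) (P : probability T R).
Variable X : nat -> {RV P >-> R}.

Let xF : \bar R := right_end_point (marginal_df X).

Definition fragility_ratio (n m : nat) (A : set nat) (s : R) : R :=
  fine (P [set w | A (nb_exceedances X s n w)]) /
  fine (P [set w | (m <= nb_exceedances X s n w)%N]).

(* The first conjunct says that the conditional laws are defined for [s] close
   to the right end point: division by 0 is total in MathComp. *)
Definition fragility_exists (n m : nat) : Prop :=
  (\forall s \near from_below xF,
     (0 < P [set w | (m <= nb_exceedances X s n w)%N])%E) /\
  (forall A : set nat, A `<=` [set k | (m <= k <= n)%N] ->
     cvg (fragility_ratio n m A s @[s --> from_below xF])).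

(* FD_{n,m}, carried by {m, ..., n} and extended by 0 to a set function on
   subsets of Z_m. *)
Definition fragility (n m : nat) (A : set nat) : R :=
  lim (fragility_ratio n m (A `&` [set k | (m <= k <= n)%N]) s
         @[s --> from_below xF]).

End fragility_distribution.

Definition addn_pair (p : nat * nat) : nat := (p.1 + p.2)%N.

Lemma measurable_addn_pair : measurable_fun [set: nat * nat] addn_pair.
Proof.
move=> _ A _; rewrite setTI.
have -> : addn_pair @^-1` A = \bigcup_i \bigcup_j
    (if addn_pair (i, j) \in A then [set i] `*` [set j] else set0).
  apply/seteqP; split=> [[i j] /= Aij|[a b] [i _ [j _]]].
    by exists i => //; exists j => //; rewrite mem_set.
  by case: ifPn => // /set_mem Aij [/= -> ->].
apply: bigcup_measurable => i _; apply: bigcup_measurable => j _.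
by case: ifPn => // _; exact: measurableX.
Qed.

HB.instance Definition _ :=
  isMeasurableFun.Build _ _ _ _ addn_pair measurable_addn_pair.

Section compound_poisson.
Context (R : realType).
Implicit Types mu nu : probability nat R.

Definition conv mu nu : probability nat R :=
  distribution (mu \x nu)%E addn_pair.

Fixpoint conv_pow mu (j : nat) : probability nat R :=
  if j is j'.+1 then conv mu (conv_pow mu j') else \d_0%N.

(* The least [i] such that the [i]-fold convolution of [mu] charges Z_m
   (arbitrarily 0 if there is none). *)
Definition conv_index mu (m : nat) : nat :=
  xget 0%N [set i | (0 < conv_pow mu i (Zge m))%E /\
    forall j, (0 < conv_pow mu j (Zge m))%E -> (i <= j)%N].

(* [N] has the law of xi_1 + ... + xi_Z, with Z, xi_1, xi_2, ... independent,
   Z Poisson of mean [lambda] and xi_i of law [mu]; these variables may live on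
   another probability space.  The second argument of the library's
   [poisson_prob] is a dummy. *)
Definition compound_poisson d (T : measurableType d) (Q : probability T R)
    (N : {RV Q >-> nat}) (lambda : R) mu : Prop :=
  exists d' (T' : measurableType d') (Q' : probability T' R)
    (Z : {RV Q' >-> nat}) (xi : nat -> {RV Q' >-> nat}),
    [/\ mutually_independent (fun i => if i is j.+1 then xi j else Z),
        forall A : set nat, distribution Q' Z A = poisson_prob lambda 0 A,
        forall i (A : set nat), distribution Q' (xi i) A = mu A &
        forall A : set nat, distribution Q N A =
          Q' [set w | A (\sum_(i < Z w) xi i w)%N]].

End compound_poisson.

(* Main.v *)
Require Import Defs.
From mathcomp Require Import all_boot all_order all_algebra.
From mathcomp Require Import all_classical all_reals all_analysis.
From mathcomp Require Import measurable_realfun ring lra.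
Import Order.TTheory GRing.Theory Num.Theory.
Import numFieldNormedType.Exports.
Local Open Scope classical_set_scope.
Local Open Scope ring_scope.

(** Write pi^j for the j-fold convolution of [mu], I for [conv_index mu m] and
    N^tau for the compound Poisson variable of rate lambda = theta * tau.

    The proof exchanges the limits n -> oo and tau -> 0.  For fixed n the
    threshold u_n^(tau) tends to the right end point from below as tau -> 0, so
    the law of the number of exceedances of u_n^(tau), conditioned on being at
    least m, tends to FD_{n,m} ([cond_prob_fragility_cvg]).  For fixed tau it
    tends, as n -> oo, to the law of N^tau conditioned on N^tau >= m, uniformly
    in tau.  Hence FD_{n,m}({k}) converges to the limit of
    P(N^tau = k | N^tau >= m) as tau -> 0 ([cvg_of_uniform_limit]).

    That last limit comes from the expansion
      P(N^tau in A) = sum_j e^(-lambda) lambda^j / j! * pi^j(A)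
    ([compound_poissonE]).  If A is a set of integers >= m, the terms with
    j < I vanish by the choice of I, and those with j > I add up to at most
    lambda^(I+1) ([compound_series_bounds]); so
    P(N^tau in A) / lambda^I tends to pi^I(A) / I!, and the conditional
    probability tends to pi^I(A) / pi^I(Z_m) ([compound_series_ratio]): as the
    rate vanishes, the likeliest way to reach m is with exactly I clusters.  The
    index I exists because clusters are nonempty, so that m of them always
    suffice ([conv_pow_ge]).

    The limit pi^I( . | Z_m) has total mass 1, so no mass escapes to infinity
    and the convergence of point masses gives convergence on every set
    ([cvg_of_pointwise_cvg]).  For m = 1 the index is 1 and pi^1 = [mu] is
    carried by Z_1. *)

(** * Convolution powers *)

(** Total probability over the values of [Z]. *)
Lemma measure_fiber_sum {d} {T : measurableType d} {R : realType}
    (mu : {measure set T -> \bar R}) (Z : T -> nat) (A : set T) :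
  (forall k, measurable (A `&` Z @^-1` [set k])) ->
  mu A = (\sum_(0 <= k <oo) mu (A `&` Z @^-1` [set k]))%E.
Proof.
move=> mAZ; rewrite -measure_semi_bigcup //.
- congr (mu _); apply/seteqP; split=> [w Aw|w [k _ []] //].
  by exists (Z w).
- by move=> i j _ _ [w [[_ /= <-] [_ /= <-]]].
- exact: bigcup_measurable.
Qed.

Lemma convE {R : realType} (mu nu : probability nat R) (A : set nat) :
  Defs.conv mu nu A =
  (\sum_(0 <= a <oo) mu [set a] * nu [set b | A (a + b)%N])%E.
Proof.
have slice k : (addn_pair @^-1` A) `&` fst @^-1` [set k] =
    [set k] `*` [set b | A (k + b)%N].
  apply/seteqP; split=> [[a b] [/= + ak]|[a b] [/= ->]] //.
  by rewrite ak.
apply: etrans (measure_fiber_sum (mu \x nu)%E fst (addn_pair @^-1` A) _) _.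
  by move=> k; rewrite slice; exact: measurableX.
by apply: eq_eseriesr => k _; rewrite slice; exact: product_measure1E.
Qed.

Lemma conv_powS {R : realType} (mu : probability nat R) j (A : set nat) :
  conv_pow mu j.+1 A =
  (\sum_(0 <= a <oo) mu [set a] * conv_pow mu j [set b | A (a + b)%N])%E.
Proof. exact: convE. Qed.

(** Each summand is at least 1 almost surely, so a sum of [j] of them is
    at least [j]. *)
Lemma conv_pow_ge {R : realType} (mu : probability nat R) j :
  mu [set 0%N] = 0%E -> conv_pow mu j (Zge j) = 1%E.
Proof.
move=> mu0; elim: j => [|j IHj]; first by rewrite /= diracE mem_set.
have le1 (A : set nat) : (conv_pow mu j A <= 1)%E by exact: probability_le1.
rewrite conv_powS -(probability_setT mu) (measure_fiber_sum _ id setT) //.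
apply: eq_eseriesr => -[|a] _; rewrite setTI; rewrite /preimage/=.
  by rewrite mu0 mul0e.
suff -> : conv_pow mu j [set b | Zge j.+1 (a.+1 + b)%N] = 1%E by rewrite mule1.
apply/eqP; rewrite eq_le le1 /= -IHj le_measure ?inE // => b /= jb.
by rewrite /Zge/= addSn ltnS (leq_trans jb) // leq_addl.
Qed.

Lemma conv_pow_index_gt0 {R : realType} (mu : probability nat R) m :
  mu [set 0%N] = 0%E -> (0 < conv_pow mu (conv_index mu m) (Zge m))%E.
Proof.
move=> mu0; rewrite /conv_index; case: xgetP => [i _ [] //|nex].
have ex : exists i, `[< (0 < conv_pow mu i (Zge m))%E >].
  by exists m; apply/asboolP; rewrite conv_pow_ge.
case: (ex_minnP ex) => i /asboolP i_gt0 imin; case: (nex i).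
by split=> // j j_gt0; apply/imin/asboolP.
Qed.

(** By minimality of [conv_index mu m], any mass of [A], hence of [Zge m],
    bounds the index by [j]. *)
Lemma conv_pow_lt_index {R : realType} (mu : probability nat R) m j
    (A : set nat) :
  mu [set 0%N] = 0%E -> A `<=` Zge m ->
  (j < conv_index mu m)%N -> conv_pow mu j A = 0%E.
Proof.
move=> mu0 Am jI; apply/eqP; rewrite eq_le measure_ge0 andbT leNgt.
apply/negP => A_gt0; move: jI.
have Zm_gt0 : (0 < conv_pow mu j (Zge m))%E.
  by rewrite (lt_le_trans A_gt0) // le_measure ?inE.
rewrite /conv_index; case: xgetP => [i _ [_ /(_ _ Zm_gt0)]|_].
  by rewrite leqNgt => /negP.
by rewrite ltn0.
Qed.

Lemma conv_pow1 {R : realType} (mu : probability nat R) (A : set nat) :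
  conv_pow mu 1 A = mu A.
Proof.
rewrite conv_powS (measure_fiber_sum _ id A) //.
apply: eq_eseriesr => a _; rewrite /= diracE.
rewrite (_ : _ @^-1` _ = [set a]) //.
case: (pselect (A a)) => Aa.
  rewrite mem_set ?mule1 /= ?addn0 // setIidr //.
  by move=> ? ->.
rewrite memNset /= ?addn0 // mule0 (_ : _ `&` _ = set0) ?measure0 //.
by apply/seteqP; split=> // x [] /[swap] ->.
Qed.

Lemma conv_index1 {R : realType} (mu : probability nat R) :
  mu [set 0%N] = 0%E -> conv_index mu 1 = 1%N.
Proof.
move=> mu0; have I_gt0 := conv_pow_index_gt0 mu 1 mu0.
case: (ltngtP (conv_index mu 1) 1) => // [|I_gt1].
  rewrite ltnS leqn0 => /eqP I0; move: I_gt0.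
  by rewrite I0 /= diracE memNset // ltxx.
move: (conv_pow_ge mu 1 mu0); rewrite (@conv_pow_lt_index _ _ 1) // => /eqP.
by rewrite lt_eqF.
Qed.

(** * Compound Poisson laws *)

Lemma measurable_sum_nat {d} {T : measurableType d} (n : nat)
    (f : nat -> T -> nat) :
  (forall i, measurable_fun setT (f i)) ->
  measurable_fun setT (fun w => \sum_(i < n) f i w)%N.
Proof.
move=> mf; elim: n => [|n IHn].
  by under eq_fun do rewrite big_ord0; exact: measurable_cst.
under eq_fun do rewrite big_ord_recr /=.
exact: measurable_fun_addn.
Qed.

(** The independence hypothesis is a product rule for events on individual
    variables.  Carrying along an arbitrary rectangle in the variables that do
    not enter the sum makes the induction on the length [j] of the sum go
    through: the last summand is split off by its value and joins the
    rectangle.  The index 0 is kept out of the sum: it will be the number of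
    clusters. *)
Lemma partial_sum_law {d} {T : measurableType d} {R : realType}
    {P : probability T R} (W : nat -> {RV P >-> nat}) (mu : probability nat R) :
  mutually_independent W ->
  (forall i (A : set nat), distribution P (W i.+1) A = mu A) ->
  forall j (A : set nat) (s : seq nat) (B : nat -> set nat),
    uniq s -> {in s, forall i, (i == 0%N) || (j < i)%N} ->
  P ([set w | A (\sum_(i < j) W i.+1 w)%N] `&`
      \bigcap_(i in [set` s]) (W i @^-1` B i)) =
  (conv_pow mu j A * \prod_(i <- s) P (W i @^-1` B i))%E.
Proof.
move=> indep lawW; elim=> [|j IHj] A s B us sj.
  have -> : [set w | A (\sum_(i < 0) W i.+1 w)%N] = [set w | A 0%N].
    by apply/seteqP; split=> w /=; rewrite big_ord0.
  rewrite /= -indep // diracE; case: (pselect (A 0%N)) => A0.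
    rewrite mem_set // mul1e; congr (P _).
    by apply/seteqP; split=> [w []|w].
  rewrite memNset // mul0e (_ : _ `&` _ = set0) ?measure0 //.
  by apply/seteqP; split=> // w [].
(* The rectangle enlarged by the event that the last summand is a. *)
pose B' a i := if i == j.+1 then [set a] else B i.
have jNs : j.+1 \notin s by apply/negP => /sj; rewrite /= ltnn.
have B's a i : i \in s -> B' a i = B i.
  by rewrite /B'; case: eqP => // -> jin; rewrite jin in jNs.
set E := (X in P X).
have fiber a : E `&` W j.+1 @^-1` [set a] =
    [set w | A (a + \sum_(i < j) W i.+1 w)%N] `&`
      \bigcap_(i in [set` j.+1 :: s]) (W i @^-1` B' a i).
  apply/seteqP; split=> [w [[/= Aw Bw] Wa]|w [/= Aw Bw]].
    split=> /=; first by move: Aw; rewrite big_ord_recr /= Wa addnC.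
    move=> i /=; rewrite in_cons => /predU1P[->|si].
      by rewrite /B' eqxx.
    by rewrite B's //; exact: Bw.
  have Wa : W j.+1 w = a by have := Bw j.+1 (mem_head _ _); rewrite /B' eqxx.
  split=> //; split=> /=; first by rewrite big_ord_recr /= Wa addnC.
  move=> i /= si; rewrite -(B's a) //; apply: Bw => /=.
  by rewrite in_cons si orbT.
rewrite (measure_fiber_sum _ (W j.+1)); last first.
  move=> a; rewrite fiber; apply: measurableI.
    rewrite -[X in measurable X]setTI.
    exact: (measurable_sum_nat j (fun i => W i.+1)
      (fun i => measurable_funPT (W i.+1)) measurableT
      [set b | A (a + b)%N]).
  by apply: fin_bigcap_measurable => // i _; exact: measurable_funPTI.
have Pfin : (\prod_(i <- s) P (W i @^-1` B i))%E \is a fin_num.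
  rewrite prode_fin_num // => i _; rewrite fin_num_measure //.
  exact: measurable_funPTI.
rewrite conv_powS -(fineK Pfin) muleC -nneseriesZl; last first.
  by move=> a _; rewrite mule_ge0.
apply: eq_eseriesr => a _; rewrite fiber.
apply: etrans (IHj [set b | A (a + b)%N] (j.+1 :: s) (B' a) _ _) _.
- by rewrite /= jNs.
- move=> i; rewrite in_cons => /predU1P[->|/sj]; first by rewrite leqnn orbT.
  by case/orP => [->|/ltnW ->] //; rewrite orbT.
rewrite big_cons.
have -> : (\prod_(i <- s) P (W i @^-1` B' a i) =
           \prod_(i <- s) P (W i @^-1` B i))%E.
  by rewrite !big_seq; apply: eq_bigr => i si; rewrite (B's a i si).
rewrite fineK // {1}/B' eqxx.
have -> : P (W j.+1 @^-1` [set a]) = mu [set a] := lawW j [set a].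
by rewrite muleCA muleA muleC.
Qed.

(** Conditioning on the number of clusters. *)
Lemma compound_poissonE {R : realType} {mu : probability nat R} {d}
    {T : measurableType d} {Q : probability T R} {N : {RV Q >-> nat}}
    {lambda : R} (A : set nat) :
  0 < lambda -> compound_poisson N lambda mu ->
  distribution Q N A =
  (\sum_(0 <= j <oo) (poisson_pmf lambda j)%:E * conv_pow mu j A)%E.
Proof.
move=> lambda0 [d' [T' [Q' [Z [xi [indep Zlaw xilaw ->]]]]]].
pose W i := if i is j.+1 then xi j else Z.
have fiber j : [set w | A (\sum_(i < Z w) xi i w)%N] `&` Z @^-1` [set j] =
    [set w | A (\sum_(i < j) W i.+1 w)%N] `&`
      \bigcap_(i in [set` [:: 0%N]]) (W i @^-1` [set j]).
  apply/seteqP; split=> [w [/= Aw Zj]|w [/= Aw /(_ 0%N) /= Zj]].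
    split; first by rewrite -Zj.
    by move=> i; rewrite /= inE => /eqP ->.
  have {}Zj : Z w = j by apply: Zj; rewrite inE.
  by split=> //; rewrite Zj.
rewrite (measure_fiber_sum _ Z); last first.
  move=> j; rewrite fiber; apply: measurableI.
    rewrite -[X in measurable X]setTI.
    exact: (measurable_sum_nat j (fun i => W i.+1)
      (fun i => measurable_funPT (W i.+1)) measurableT A).
  by apply: fin_bigcap_measurable => // i _; exact: measurable_funPTI.
apply: eq_eseriesr => j _; rewrite fiber.
apply: etrans (partial_sum_law W mu indep xilaw j A [:: 0%N]
  (fun=> [set j]) _ _) _ => //.
  by move=> i; rewrite inE => ->.
rewrite big_seq1 muleC; congr (_ * _)%E.
apply: etrans (Zlaw [set j]) _.
by rewrite /poisson_prob lambda0 esum_set1 // lee_fin poisson_pmf_ge0.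
Qed.

(** This is the inequality i! <= (i + k)!.  Summed over [i], it bounds the tail
    of the Poisson law from rank [k] on by [lambda ^+ k]. *)
Lemma poisson_pmf_shift {R : realType} (lambda : R) i k : 0 < lambda ->
  poisson_pmf lambda (i + k) <= lambda ^+ k * poisson_pmf lambda i.
Proof.
move=> lambda0; rewrite /poisson_pmf lambda0 !mulrA.
apply: ler_wpM2r; first exact: expR_ge0.
rewrite exprD [X in X / _]mulrC ler_wpM2l //.
  by rewrite mulr_ge0 ?exprn_ge0 ?(ltW lambda0).
rewrite lef_pV2 ?posrE ?ltr0n ?fact_gt0 // ler_nat.
elim: k => [|k IHk]; first by rewrite addn0.
by rewrite addnS factS (leq_trans IHk) // leq_pmull.
Qed.

Lemma nneseries_poisson_pmf {R : realType} (lambda : R) : 0 < lambda ->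
  (\sum_(0 <= j <oo) (poisson_pmf lambda j)%:E = 1)%E.
Proof.
move=> lambda0; rewrite nneseries_esumT; last first.
  by move=> j; rewrite lee_fin poisson_pmf_ge0.
have : poisson_prob lambda 0 setT = 1%E by exact: probability_setT.
by rewrite /poisson_prob lambda0.
Qed.

Definition compound_series {R : realType} (mu : probability nat R)
    (A : set nat) (lambda : R) : \bar R :=
  (\sum_(0 <= j <oo) (poisson_pmf lambda j)%:E * conv_pow mu j A)%E.

(** One convolution power carries the leading order in [lambda]: lower ones
    vanish on [A], and the higher ones, bounded by 1, are absorbed in the
    Poisson tail. *)
Lemma compound_series_bounds {R : realType} (mu : probability nat R) m
    (A : set nat) (lambda : R) (I := conv_index mu m) :
  mu [set 0%N] = 0%E -> A `<=` Zge m -> 0 < lambda ->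
  ((poisson_pmf lambda I)%:E * conv_pow mu I A <=
    compound_series mu A lambda <=
    (poisson_pmf lambda I)%:E * conv_pow mu I A + (lambda ^+ I.+1)%:E)%E.
Proof.
move=> mu0 Am lambda0.
have pmf_ge0 j : (0 <= (poisson_pmf lambda j)%:E)%E.
  by rewrite lee_fin poisson_pmf_ge0.
have term_ge0 j : (0 <= (poisson_pmf lambda j)%:E * conv_pow mu j A)%E.
  exact: mule_ge0.
rewrite /compound_series (@nneseries_split _ _ 0 I.+1) // add0n.
rewrite big_nat_recr //= big_nat_cond big1 => [|j]; last first.
  by rewrite andbT => jI; rewrite (conv_pow_lt_index mu m) ?mule0.
rewrite add0e leeDl ?nneseries_ge0 //= leeD2l //.
rewrite -nneseries_addn // -[leRHS]mule1 -(nneseries_poisson_pmf _ lambda0).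
rewrite -nneseriesZl //; apply: lee_nneseries => [j _ _|j _] //.
rewrite -EFinM.
apply: (@le_trans _ _ ((poisson_pmf lambda (j + I.+1))%:E * 1)%E).
  by rewrite lee_wpmul2l // probability_le1.
by rewrite mule1 lee_fin poisson_pmf_shift.
Qed.

(** Squeeze between [lo], the normalised leading term, and [lo + lambda]. *)
Lemma compound_series_small_rate {R : realType} (mu : probability nat R) m
    (A : set nat) (I := conv_index mu m) :
  mu [set 0%N] = 0%E -> A `<=` Zge m ->
  fine (compound_series mu A lambda) / lambda ^+ I @[lambda --> 0^'+] -->
    fine (conv_pow mu I A) / I`!%:R.
Proof.
move=> mu0 Am; set c := fine _.
have cE : conv_pow mu I A = c%:E by rewrite /c fineK // fin_num_measure.
pose lo (lambda : R) := expR (- lambda) * (c / I`!%:R).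
have lo_cvg : lo lambda @[lambda --> 0^'+] --> c / I`!%:R.
  rewrite -[X in _ --> X]mul1r; apply: cvgM; last exact: cvg_cst.
  have e0 : expR (- 0) = 1 :> R by rewrite oppr0 expR0.
  rewrite -[X in _ --> X]e0; apply: cvg_at_right_filter.
  apply: (continuous_comp (x := 0 : R) (f := fun x : R => - x) (g := expR)).
    exact: opp_continuous.
  exact: continuous_expR.
apply: (@squeeze_cvgr _ _ _ _ lo (fun l => lo l + l)) => //; last first.
  rewrite -[X in _ --> X]addr0; apply: cvgD => //.
  exact: cvg_at_right_filter cvg_id.
near=> lambda.
have lambda0 : 0 < lambda by near: lambda; exact: nbhs_right_gt.
have := compound_series_bounds mu m A lambda mu0 Am lambda0.
rewrite -/I cE -EFinM -EFinD => /andP[lo_le le_hi].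
have fin : compound_series mu A lambda \is a fin_num.
  by rewrite fin_numE; apply/andP; split; apply/eqP => E;
    rewrite E in lo_le le_hi.
move: lo_le le_hi; rewrite -(fineK fin) !lee_fin.
have -> : poisson_pmf lambda I * c = lo lambda * lambda ^+ I.
  by rewrite /poisson_pmf lambda0 /lo;
    (* Abstracting first keeps [ring] from computing the factorial of [I]. *)
    move: (lambda ^+ I) (_`!%:R^-1) (expR _) => x y z; ring.
rewrite ler_pdivlMr ?exprn_gt0 // ler_pdivrMr ?exprn_gt0 // => -> /=.
by rewrite mulrDl -exprS.
Unshelve. all: by end_near. Qed.

Lemma compound_series_ratio {R : realType} (mu : probability nat R) m
    (A : set nat) (I := conv_index mu m) :
  mu [set 0%N] = 0%E -> A `<=` Zge m ->
  fine (compound_series mu A lambda) / fine (compound_series mu (Zge m) lambda)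
    @[lambda --> 0^'+] -->
    fine (conv_pow mu I A) / fine (conv_pow mu I (Zge m)).
Proof.
move=> mu0 Am.
have I0 : I`!%:R != 0 :> R by rewrite pnatr_eq0 -lt0n fact_gt0.
have den0 : fine (conv_pow mu I (Zge m)) != 0.
  by rewrite fine_eq0 ?fin_num_measure // gt_eqF // conv_pow_index_gt0.
have -> : fine (conv_pow mu I A) / fine (conv_pow mu I (Zge m)) =
    (fine (conv_pow mu I A) / I`!%:R) /
    (fine (conv_pow mu I (Zge m)) / I`!%:R).
  by field; rewrite I0 den0.
have cA := compound_series_small_rate mu m A mu0 Am.
have cZ := compound_series_small_rate mu m (Zge m) mu0 (@subset_refl _ _).
apply: cvg_trans (cvgM cA (cvgV _ cZ)); last first.
  by rewrite mulf_neq0 // invr_eq0.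
apply: near_eq_cvg; near=> lambda.
have lambda0 : 0 < lambda by near: lambda; exact: nbhs_right_gt.
rewrite /= invfM invrK mulrACA [_^-1 * _]mulVf ?mulr1 //.
by rewrite expf_neq0 // gt_eqF.
Unshelve. all: by end_near. Qed.

Lemma compound_poisson_cond_cvg {R : realType} (mu : probability nat R) m k
    (theta : R) (d : R -> measure_display)
    (T : forall tau : R, measurableType (d tau))
    (Q : forall tau : R, probability (T tau) R)
    (N : forall tau : R, {RV (Q tau) >-> nat}) :
  mu [set 0%N] = 0%E -> (m <= k)%N -> 0 < theta ->
  (forall tau : R, 0 < tau -> compound_poisson (N tau) (theta * tau) mu) ->
  cond_prob (Q tau) [set w | N tau w = k] [set w | (m <= N tau w)%N]
    @[tau --> 0^'+] -->
  fine (conv_pow mu (conv_index mu m) [set k]) /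
  fine (conv_pow mu (conv_index mu m) (Zge m)).
Proof.
move=> mu0 mk theta0 Ncp.
have km : [set k] `<=` Zge m by move=> _ ->.
have theta_cvg : theta * tau @[tau --> 0^'+] --> 0^'+.
  have theta_cvg0 : theta * tau @[tau --> 0^'+] --> (0 : R).
    apply: cvg_at_right_filter.
    by rewrite -[X in _ --> X](mulr0 theta); exact: mulrl_continuous.
  move=> B B0; suff: \forall tau \near 0^'+, B (theta * tau) by [].
  near=> tau.
  have : 0 < theta * tau -> B (theta * tau).
    by near: tau; exact: (theta_cvg0 _ B0).
  by apply; rewrite mulr_gt0 //; near: tau; exact: nbhs_right_gt.
apply: cvg_trans (cvg_comp _ _ theta_cvg (compound_series_ratio mu m _ mu0 km)).
apply: near_eq_cvg; near=> tau.
have tau0 : 0 < tau by near: tau; exact: nbhs_right_gt.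
have thetatau0 : 0 < theta * tau by rewrite mulr_gt0.
rewrite /= /compound_series -!(compound_poissonE _ thetatau0 (Ncp _ tau0)).
rewrite /cond_prob; congr (fine (Q tau _) / _).
by apply/seteqP; split=> [w /= ->|w []].
Unshelve. all: by end_near. Qed.

(** * Convergence of laws on the integers *)

(** Finite additivity is all that survives, without further argument, in a
    setwise limit of probabilities such as FD_{n,m}. *)
Definition finitely_additive_prob {R : realType} (G : set nat -> R) : Prop :=
  [/\ forall A, 0 <= G A, G setT = 1 &
      forall A B, A `&` B = set0 -> G (A `|` B) = G A + G B].

Lemma fine_finitely_additive {R : realType} (p : probability nat R) :
  finitely_additive_prob (fun A => fine (p A)).
Proof.
split=> [A|/=|A B AB /=]; first exact: fine_ge0.
  by rewrite probability_setT.
by rewrite measureU // fineD // fin_num_measure.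
Qed.

(** A form of the lemma of Scheffe.  Convergence of point masses passes to
    finite sets, and approximating [A] from inside by finite sets gives
    liminf F_n(A) >= p(A).  The same bound for the complement of [A], together
    with the common total mass 1, gives the upper bound. *)
Lemma cvg_of_pointwise_cvg {R : realType} (F : nat -> set nat -> R)
    (p : probability nat R) :
  (\forall n \near \oo, finitely_additive_prob (F n)) ->
  (forall k, F n [set k] @[n --> \oo] --> fine (p [set k])) ->
  forall A, F n A @[n --> \oo] --> fine (p A).
Proof.
move=> Fprob Fk.
have [_ _ pU] := fine_finitely_additive p.
have set0E (G : set nat -> R) : finitely_additive_prob G -> G set0 = 0.
  case=> _ _ GU; have := GU set0 set0 (setI0 _); rewrite setU0 => /eqP.
  by rewrite -subr_eq0 opprD addrA subrr sub0r oppr_eq0 => /eqP.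
have head_cvg A K : F n (A `&` [set k | (k < K)%N]) @[n --> \oo] -->
    fine (p (A `&` [set k | (k < K)%N])).
  elim: K => [|K IHK].
    rewrite (_ : A `&` _ = set0); last by apply/seteqP; split=> // k [].
    rewrite measure0; apply: cvg_near_cst.
    by apply: filterS Fprob => n /set0E.
  have [AK|nAK] := pselect (A K); last first.
    rewrite (_ : A `&` _ = A `&` [set k | (k < K)%N]) //.
    apply/seteqP; split=> k [Ak kK]; split=> //=; last exact: ltnW.
    by move: kK; rewrite /= ltnS leq_eqVlt => /predU1P[kE|//]; rewrite kE in Ak.
  have splitK : A `&` [set k | (k < K.+1)%N] =
      (A `&` [set k | (k < K)%N]) `|` [set K].
    apply/seteqP; split=> k /=.
      by case=> Ak; rewrite ltnS leq_eqVlt => /predU1P[->|]; [right|left].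
    by case=> [[Ak kK]|->]; split=> //; exact: ltnW.
  have disjK : (A `&` [set k | (k < K)%N]) `&` [set K] = set0.
    by apply/seteqP; split=> // k [[_ /= kK] kE]; rewrite kE ltnn in kK.
  rewrite splitK pU //.
  apply: cvg_trans (cvgD IHK (Fk K)); apply: near_eq_cvg.
  by apply: filterS Fprob => n [_ _ ->].
have lower A eps : 0 < eps ->
    \forall n \near \oo, fine (p A) - eps <= F n A.
  move=> eps0.
  have : fine (p (A `&` [set k | (k < K)%N])) @[K --> \oo] --> fine (p A).
    have bigA : \bigcup_K (A `&` [set k | (k < K)%N]) = A.
      apply/seteqP; split=> [k [K _ []] //|k Ak].
      by exists k.+1 => //=; split=> /=.
    apply: fine_cvg; rewrite fineK ?fin_num_measure // -[X in p X]bigA.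
    apply: nondecreasing_cvg_mu => // K L KL; apply/subsetPset => k [Ak kK].
    by split=> //=; exact: leq_trans kK KL.
  have lt2 : fine (p A) - eps / 2 < fine (p A).
    by rewrite ltrBlDr ltrDl divr_gt0.
  move=> /cvgr_gt /(_ _ lt2) [K _ /(_ K (leqnn _)) /= pK].
  have lt3 : fine (p A) - eps < fine (p (A `&` [set k | (k < K)%N])) by lra.
  apply: filterS2 Fprob (cvgr_gt _ (head_cvg A K) _ lt3) => n [F0 _ FU] FK.
  rewrite (le_trans (ltW FK)) // -[in leRHS](setUIDK A [set k | (k < K)%N]).
  by rewrite FU ?lerDl // setDE setIACA setICr setI0.
move=> A; apply/cvgrPdist_le => eps eps0.
have pC : fine (p A) + fine (p (~` A)) = 1.
  by rewrite -pU ?setICr // setUCr /= probability_setT.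
apply: filterS3 Fprob (lower A _ eps0) (lower (~` A) _ eps0).
move=> n [_ F1 FU] lA lC.
have FC : F n A + F n (~` A) = 1 by rewrite -FU ?setICr // setUCr.
by rewrite ler_norml; lra.
Qed.

(** Exchange of limits: letting [tau] tend to 0 in |g(tau) - f_n(tau)| <= eps,
    which holds on all of ]0, tau0] for large n, gives |b - a_n| <= eps. *)
Lemma cvg_of_uniform_limit {R : realType} (f : nat -> R -> R) (g : R -> R)
    (tau0 : R) (a : nat -> R) (b : R) :
  0 < tau0 ->
  {uniform `]0, tau0], f @ \oo --> g} ->
  (\forall n \near \oo, f n tau @[tau --> 0^'+] --> a n) ->
  g tau @[tau --> 0^'+] --> b ->
  a n @[n --> \oo] --> b.
Proof.
move=> tau00 fg fa gb; apply/cvgrPdist_le => eps eps0.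
have g_nbhs : nbhs (g : {uniform` [set` `]0, tau0]] -> R})
    [set h : R -> R | forall tau, tau \in `]0, tau0] -> `|g tau - h tau| < eps].
  apply/uniform_nbhs; exists [set xy : R * R | ball xy.1 eps xy.2]; split=> //.
  exact: (entourage_ball _ (PosNum eps0)).
have fg_close : \forall n \near \oo, forall tau, tau \in `]0, tau0] ->
    `|g tau - f n tau| < eps := fg _ g_nbhs.
apply: filterS2 fa fg_close => n fa_n fg_n.
have dist_cvg : `|g tau - f n tau| @[tau --> 0^'+] --> `|b - a n|.
  by apply: cvg_norm; exact: cvgB.
apply: (cvgr_to_le dist_cvg); near=> tau.
by apply/ltW/fg_n; rewrite in_itv/=; apply/andP; split;
  near: tau; [exact: nbhs_right_gt|exact: nbhs_right_le].
Unshelve. all: by end_near. Qed.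

(** * The fragility distribution *)

(** The thresholds stay strictly below the right end point, so when it is finite
    they tend to it from the left. *)
Lemma threshold_cvg {R : realType} (F : R -> R) (u : R -> nat -> R) n :
  normalising_thresholds F u -> (0 < n)%N ->
  u tau n @[tau --> 0^'+] --> from_below (right_end_point F).
Proof.
move=> [u_lt _ u_cvg] n0; have {}u_cvg := u_cvg n n0.
have {}u_lt tau : 0 < tau -> ((u tau n)%:E < right_end_point F)%E.
  by move=> tau0; exact: u_lt.
case: (right_end_point F) u_lt u_cvg => [r||] u_lt u_cvg /=.
- have {}u_cvg : u tau n @[tau --> 0^'+] --> r by exact: (fine_cvg u_cvg).
  move=> B B_r; suff: \forall tau \near 0^'+, B (u tau n) by [].
  near=> tau; have : u tau n < r -> B (u tau n).
    by near: tau; exact: (u_cvg _ B_r).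
  by apply; rewrite -lte_fin u_lt //; near: tau; exact: nbhs_right_gt.
- exact/cvgeryP.
- exact/cvgerNyP.
Unshelve. all: by end_near. Qed.

Section exceedances.
Context {d : measure_display} {T : measurableType d} {R : realType}.
Context {P : probability T R}.
Variable X : nat -> {RV P >-> R}.

Lemma nb_exceedances_le (s : R) n w : (nb_exceedances X s n w <= n)%N.
Proof.
rewrite /nb_exceedances -[leqRHS]card_ord -sum1_card.
by apply: leq_sum => i _; case: (_ < _).
Qed.

Lemma measurable_nb_exceedances (s : R) n (A : set nat) :
  measurable [set w | A (nb_exceedances X s n w)].
Proof.
rewrite -[X in measurable X]setTI.
apply: (measurable_sum_nat n (fun i w => nat_of_bool (s < X i w))) => // i.
have mX := measurable_fun_ltr (measurable_cst s) (measurable_funPT (X i)).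
move=> mT Y _.
rewrite (_ : _ @^-1` Y =
  (fun w => s < X i w) @^-1` [set b | Y (nat_of_bool b)]) //.
exact: mX.
Qed.

Lemma fragility_ratio_cvg n m (A : set nat) :
  fragility_exists X n m ->
  fragility_ratio X n m (A `&` [set k | (m <= k <= n)%N]) s
    @[s --> from_below (right_end_point (marginal_df X))] -->
  fragility X n m A.
Proof. by move=> [_ FD]; apply: FD => k []. Qed.

(** Inherited from the conditional laws by passing to the limit.  For the total
    mass, the ratio is eventually 1 because the conditioning event eventually
    has positive probability. *)
Lemma fragility_finitely_additive n m :
  fragility_exists X n m -> finitely_additive_prob (fragility X n m).
Proof.
move=> FDe; have FD_cvg A := fragility_ratio_cvg n m A FDe.
case: FDe => N_gt0 _; split=> [A||A B AB].
- apply: (cvgr_to_ge (FD_cvg A)); near=> s.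
  by rewrite /fragility_ratio divr_ge0 // fine_ge0.
- apply: cvg_lim => //; apply: cvg_near_cst.
  apply: filterS N_gt0 => s Ns_gt0; rewrite /fragility_ratio.
  have -> : [set w | (setT `&` [set k | (m <= k <= n)%N])
      (nb_exceedances X s n w)] = [set w | (m <= nb_exceedances X s n w)%N].
    apply/seteqP; split=> w /=; first by case=> _ /andP[].
    by move=> mN; rewrite mN nb_exceedances_le.
  rewrite divff // fine_eq0 ?gt_eqF //.
  by rewrite fin_num_measure //; exact: (measurable_nb_exceedances s n (Zge m)).
- apply: cvg_lim => //.
  apply: cvg_trans (cvgD (FD_cvg A) (FD_cvg B)); apply: near_eq_cvg.
  near=> s; set I := [set k | (m <= k <= n)%N].
  rewrite -[LHS]/(fragility_ratio X n m (A `&` I) s +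
                  fragility_ratio X n m (B `&` I) s).
  rewrite /fragility_ratio -mulrDl -fineD; last 2 first.
  + by rewrite fin_num_measure //; exact: measurable_nb_exceedances.
  + by rewrite fin_num_measure //; exact: measurable_nb_exceedances.
  rewrite -measureU; first by rewrite setIUl.
  + exact: measurable_nb_exceedances.
  + exact: measurable_nb_exceedances.
  + apply/seteqP; split=> // w [[Aw _] [Bw _]].
    by have : (A `&` B) (nb_exceedances X s n w) by []; rewrite AB.
Unshelve. all: by end_near. Qed.

(** For fixed [n], the conditional point mass is the ratio defining FD_{n,m}
    evaluated along the thresholds. *)
Lemma cond_prob_fragility_cvg (u : R -> nat -> R) n m k :
  normalising_thresholds (marginal_df X) u -> fragility_exists X n m ->
  (0 < n)%N -> (m <= k <= n)%N ->
  cond_prob P [set w | nb_exceedances X (u tau n) n w = k]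
    [set w | (m <= nb_exceedances X (u tau n) n w)%N]
    @[tau --> 0^'+] --> fragility X n m [set k].
Proof.
move=> u_thr FDe n0 mkn.
apply: cvg_trans (cvg_comp _ _ (threshold_cvg _ u n u_thr n0)
  (fragility_ratio_cvg n m [set k] FDe)).
apply: near_eq_cvg; near=> tau; rewrite /= /fragility_ratio /cond_prob.
congr (fine (P _) / _); apply/seteqP; split=> w /=.
  by case=> -> /andP[].
by case=> -> _.
Unshelve. all: by end_near. Qed.

End exceedances.

(** The fallback value [nu] of the normalisation, for [nu D = 0], is
    arbitrary. *)
Definition conditional_law {R : realType} (nu : probability nat R)
    (D : set nat) : probability nat R :=
  mnormalize (mrestr nu (Logic.I : measurable D)) nu.

Lemma conditional_lawE {R : realType} (nu : probability nat R) (D A : set nat) :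
  (0 < nu D)%E ->
  fine (conditional_law nu D A) = fine (nu (A `&` D)) / fine (nu D).
Proof.
move=> D_gt0; have D_fin : nu D \is a fin_num by rewrite fin_num_measure.
rewrite -[conditional_law nu D A]/((if (nu (setT `&` D) == 0%E) ||
    (nu (setT `&` D) == +oo%E) then fun U => nu U else
    fun U => (nu (U `&` D) * ((fine (nu (setT `&` D)))^-1)%:E)%E) A).
rewrite setTI.
rewrite gt_eqF //= ifF; last by apply/eqP => E; rewrite E in D_fin.
by rewrite fineM // fin_num_measure.
Qed.

Theorem theorem3p1 (R : realType) (d : measure_display) (T : measurableType d)
    (P : probability T R) (X : nat -> {RV P >-> R}) (u : R -> nat -> R)
    (m : nat) (theta : R) (mu : probability nat R)
    (d' : R -> measure_display) (T' : forall tau : R, measurableType (d' tau))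
    (Q : forall tau : R, probability (T' tau) R)
    (N : forall tau : R, {RV (Q tau) >-> nat}) (tau0 : R) :
  (1 <= m)%N ->
  stationary X ->
  (1 - marginal_df X s) / (1 - left_limit (marginal_df X) s)
    @[s --> from_below (right_end_point (marginal_df X))] --> (1 : R) ->
  normalising_thresholds (marginal_df X) u ->
  (\forall n \near \oo, fragility_exists X n m) ->
  0 < theta ->
  mu [set 0%N] = 0%E ->
  (forall tau : R, 0 < tau -> compound_poisson (N tau) (theta * tau) mu) ->
  0 < tau0 ->
  (forall k : nat, (m <= k)%N ->
     {uniform `]0, tau0],
       (fun (n : nat) (tau : R) =>
          cond_prob P
            [set w | nb_exceedances X (u tau n) n w = k]
            [set w | (m <= nb_exceedances X (u tau n) n w)%N]) @ \oo -->
       (fun tau : R =>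
          cond_prob (Q tau) [set w | N tau w = k]
            [set w | (m <= N tau w)%N])}) ->
  (forall A : set nat, A `<=` Zge m ->
     fragility X n m A @[n --> \oo] -->
       fine (conv_pow mu (conv_index mu m) A) /
       fine (conv_pow mu (conv_index mu m) (Zge m))) /\
  (m = 1%N -> forall A : set nat, A `<=` Zge 1 ->
     fragility X n 1 A @[n --> \oo] --> fine (mu A)).
Proof.
move=> m_gt0 _ _ u_thr FDe theta0 mu0 Ncp tau00 Ncond.
set I := conv_index mu m; set nu := conv_pow mu I.
have nu_gt0 : (0 < nu (Zge m))%E by exact: conv_pow_index_gt0.
have lim_FD A : fragility X n m A @[n --> \oo] -->
    fine (conditional_law nu (Zge m) A).
  apply: (cvg_of_pointwise_cvg (fun n => fragility X n m)) => {A} [|k].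
    by apply: filterS FDe => n; exact: fragility_finitely_additive.
  (* A point outside Z_m has mass 0 both before and in the limit. *)
  rewrite conditional_lawE //; have [mk|km] := leqP m k; last first.
    rewrite (_ : _ `&` _ = set0) ?measure0 ?mul0r; last first.
      by apply/seteqP; split=> // j [-> /=]; rewrite /Zge/= leqNgt km.
    apply: cvg_near_cst; apply: filterS FDe => n /fragility_ratio_cvg FD_cvg.
    rewrite -(cvg_lim _ (FD_cvg [set k])) //; apply: lim_near_cst => //.
    near=> s; rewrite /fragility_ratio (_ : [set w | _] = set0).
      by rewrite measure0 mul0r.
    by apply/seteqP; split=> // w [-> /andP[]]; rewrite leqNgt km.
  rewrite setIidl; last by move=> _ ->.
  apply: (cvg_of_uniform_limit _ _ _ _ _ tau00 (Ncond k mk)).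
    near=> n; apply: cond_prob_fragility_cvg => //; first by near: n.
      by near: n; exact: nbhs_infty_gt.
    by rewrite mk; near: n; exact: nbhs_infty_ge.
  exact: (compound_poisson_cond_cvg _ _ _ theta).
split=> [A Am|m1 A A1].
  by rewrite -[X in fine (_ X) / _](setIidl Am) -conditional_lawE.
move: lim_FD; rewrite /nu /I m1 conv_index1 // => /(_ A).
rewrite conditional_lawE conv_pow_ge ?lte01 // setIidl // divr1.
by rewrite conv_pow1.
Unshelve. all: by end_near. Qed.
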